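(* For every integer $n\ge 2$, the path $P_n$ on $n$ vertices satisfies $Z_g(P_n)=2$.
   Context: All graphs are finite and simple. The game: Let $G$ be a connected graph with at least one edge; initially all vertices are white. Alice (blue) and Bob (red) alternate turns, Alice first. On each turn the player makes exactly one move: a seed move (colour one white vertex with the player's colour) or a force move $u\to v$ (if a vertex $u$ of the player's colour has exactly one white neighbour $v$, colour $v$ with the player's colour). Being the unique white neighbour is with respect to all white vertices, irrespective of who coloured the others. If a white vertex is the target of one of the player's own legal forces, colouring it counts as a force move and not as a seed move. A move blocks a legal force $u\to v$ if that force is no longer legal after the move. Force Preservation Rule: considering the opponent's legal forces (those the opponent's coloured vertices could make) at the beginning of a turn, (i) a player may always perform one of their own legal forces, even if this blocks a force of the opponent; (ii) a seed move that blocks a legal force of the opponent is permitted only when every available seed move blocks at least one of the opponent's legal forces. The game ends when every vertex is coloured. Optimal play and $Z_g$: For a position $P$ define a set $\mathcal O(P)$ of pairs. If $P$ is terminal and Alice and Bob made $s_A$ and $s_B$ seed moves in total, then $\mathcal O(P)=\{(s_A,s_B)\}$. Otherwise let $\mathcal U(P)=\bigcup_m \mathcal O(P_m)$ over all legal moves $m$, where $P_m$ is the resulting position; $\mathcal O(P)$ is the set of all pairs in $\mathcal U(P)$ with minimum first coordinate if Alice is to move, and with minimum second coordinate if Bob is to move. Let $\mathcal O(G)=\mathcal O(P_0(G))$ for the initial position $P_0(G)$. The game zero forcing number is $Z_g(G)=\min\{s_A+s_B:(s_A,s_B)\in\mathcal O(G)\}$. *)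

(* Defs.v *)
From HB Require Import structures.
From mathcomp Require Import all_boot.

Set Implicit Arguments.
Unset Strict Implicit.
Unset Printing Implicit Defensive.

Record sgraph := SGraph {
  vertex :> finType;
  adj : rel vertex;
  adj_sym : symmetric adj;
  adj_irrefl : irreflexive adj }.

Definition path_adj (n : nat) : rel 'I_n :=
  fun i j => (i.+1 == j) || (j.+1 == i).

Lemma path_adj_sym n : symmetric (@path_adj n).
Proof. by move=> i j; rewrite /path_adj orbC. Qed.

Lemma path_adj_irrefl n : irreflexive (@path_adj n).
Proof. by move=> i; rewrite /path_adj orbb eqn_leq ltnn. Qed.

Definition path_graph (n : nat) : sgraph :=
  SGraph (@path_adj_sym n) (@path_adj_irrefl n).

(* The opponent of p is ~~ p. *)
Definition player := bool.
Definition alice : player := true.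
Definition bob : player := false.

Section Game.
Variable G : sgraph.

(* None is white, Some p is the colour of player p. *)
Definition colouring := {ffun G -> option player}.

Definition white (c : colouring) : {set G} := [set v | c v == None].

Definition colour (c : colouring) (v : G) (p : player) : colouring :=
  [ffun w => if w == v then Some p else c w].

Definition legal_force (p : player) (c : colouring) (u v : G) : bool :=
  (c u == Some p) && ([set w in white c | adj u w] == [set v]).

Definition blocks (p : player) (c : colouring) (v : G) : bool :=
  [exists u, exists w,
     legal_force (~~ p) c u w && ~~ legal_force (~~ p) (colour c v p) u w].

(* Colouring the target of one's own legal force never counts as a seed move. *)
Definition available_seed (p : player) (c : colouring) (v : G) : bool :=
  (v \in white c) && ~~ [exists u, legal_force p c u v].

Definition legal_seed (p : player) (c : colouring) (v : G) : bool :=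
  available_seed p c v &&
  (blocks p c v ==> [forall w, available_seed p c w ==> blocks p c w]).

(* The position records the seed moves made so far by each player. *)
Record position := Position {
  col : colouring;
  turn : player;
  seedsA : nat;
  seedsB : nat }.

Definition initial : position := Position [ffun=> None] alice 0 0.

Definition terminal (P : position) : bool := white (col P) == set0.

Inductive move := Seed of G | Force of G & G.

Definition play (P : position) (m : move) : position :=
  let p := turn P in
  match m with
  | Seed v => Position (colour (col P) v p) (~~ p)
                (seedsA P + (p == alice)) (seedsB P + (p == bob))
  | Force _ v => Position (colour (col P) v p) (~~ p) (seedsA P) (seedsB P)
  end.

Definition legal_moves (P : position) : seq move :=
  [seq Seed v | v <- enum G & legal_seed (turn P) (col P) v] ++
  [seq Force uv.1 uv.2 | uv <- enum {: G * G} &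
     legal_force (turn P) (col P) uv.1 uv.2].

Definition seeds_of (p : player) (s : nat * nat) : nat :=
  if p == alice then s.1 else s.2.

Definition best (p : player) (U : seq (nat * nat)) : seq (nat * nat) :=
  [seq s <- U | all (fun t => seeds_of p s <= seeds_of p t) U].

(* Sets of pairs are lists up to membership. The fuel k bounds the number of
   white vertices, see outcomesE. *)
Fixpoint outcomes_rec (k : nat) (P : position) : seq (nat * nat) :=
  if terminal P then [:: (seedsA P, seedsB P)]
  else if k is k'.+1 then
    best (turn P)
      (flatten [seq outcomes_rec k' (play P m) | m <- legal_moves P])
  else [::].

Definition outcomes (P : position) : seq (nat * nat) :=
  outcomes_rec #|white (col P)| P.

(* Meant for connected G with an edge, but no definition above needs this.
   The default 0 is never reached, see outcomes_neq0. *)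
Definition Zg : nat :=
  let s := [seq st.1 + st.2 | st <- outcomes initial] in
  foldr minn (head 0 s) s.

Lemma card_white_colour (c : colouring) v p :
  v \in white c -> #|white c| = #|white (colour c v p)|.+1.
Proof.
move=> vW; rewrite (cardsD1 v) vW add1n; congr _.+1; apply: eq_card => w.
by rewrite !inE ffunE; case: (w == v).
Qed.

Lemma legal_force_white p c u v : legal_force p c u v -> v \in white c.
Proof.
case/andP=> _ /eqP/setP/(_ v).
by rewrite inE set11 => /andP[].
Qed.

Lemma eq_map_legal_moves (S : Type) (f g : move -> S) P :
    (forall m, #|white (col P)| = #|white (col (play P m))|.+1 -> f m = g m) ->
  map f (legal_moves P) = map g (legal_moves P).
Proof.
move=> fg; rewrite !map_cat -!map_comp; congr (_ ++ _).
  apply/eq_in_map=> v; rewrite mem_filter => /andP[/andP[/andP[vW _] _] _].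
  exact/fg/card_white_colour.
apply/eq_in_map=> -[u v]; rewrite mem_filter => /andP[/legal_force_white vW _].
exact/fg/card_white_colour.
Qed.

Lemma outcomes_rec_fuel j k P :
  #|white (col P)| <= j -> #|white (col P)| <= k ->
  outcomes_rec j P = outcomes_rec k P.
Proof.
elim: j k P => [|j IHj] [|k] P //=; rewrite /terminal -cards_eq0.
- by rewrite leqn0 => ->.
- by move=> _; rewrite leqn0 => ->.
case: eqP => // _ ltj ltk; congr (best _ (flatten _)).
apply: eq_map_legal_moves => m cP.
by apply: IHj; rewrite -ltnS -cP.
Qed.

Lemma outcomesE P :
  outcomes P =
    if terminal P then [:: (seedsA P, seedsB P)]
    else best (turn P)
           (flatten [seq outcomes (play P m) | m <- legal_moves P]).
Proof.
rewrite /outcomes (@outcomes_rec_fuel _ #|white (col P)|.+1) //=.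
case: ifP => // _; congr (best _ (flatten _)).
by apply: eq_map_legal_moves => m ->; apply: outcomes_rec_fuel.
Qed.

Lemma legal_moves_neq0 P : ~~ terminal P -> legal_moves P <> [::].
Proof.
case/set0Pn=> v vW noM.
have noF u w : ~~ legal_force (turn P) (col P) u w.
  apply/negP=> Fuw; move/(congr1 size): noM.
  rewrite size_cat !size_map => /eqP; rewrite addn_eq0 => /andP[_].
  by move/nilP/(congr1 (fun s => (u, w) \in s)); rewrite mem_filter mem_enum Fuw.
have noS w : ~~ legal_seed (turn P) (col P) w.
  apply/negP=> Sw; move/(congr1 size): noM.
  rewrite size_cat !size_map => /eqP; rewrite addn_eq0 => /andP[+ _].
  by move/nilP/(congr1 (fun s => w \in s)); rewrite mem_filter mem_enum Sw.
have avv : available_seed (turn P) (col P) v.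
  by rewrite /available_seed vW; apply/existsPn=> u.
have /negP[] := noS v; rewrite /legal_seed avv /=.
apply/implyP=> _; apply/forallP=> w; apply/implyP=> avw.
by apply: contraR (noS w) => nbw; rewrite /legal_seed avw (negbTE nbw).
Qed.

Lemma best_neq0 p U : U != [::] -> best p U != [::].
Proof.
case: U => // s0 U _; set V := s0 :: U.
have s0V : s0 \in V by rewrite mem_head.
have exV : exists k, has (fun s => seeds_of p s == k) V.
  by exists (seeds_of p s0); apply/hasP; exists s0.
case: (ex_minnP exV) => k /hasP[s sV /eqP sk] kmin.
suff: s \in best p V by case: (best p V).
rewrite mem_filter sV andbT; apply/allP=> t tV.
by rewrite sk; apply: kmin; apply/hasP; exists t.
Qed.

Lemma outcomes_neq0 P : outcomes P != [::].
Proof.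
have [k] := ubnP #|white (col P)|; elim: k P => // k IHk P ltk.
rewrite outcomesE; case: ifPn => // nt; apply: best_neq0.
have -> : [seq outcomes (play P m) | m <- legal_moves P] =
          [seq if outcomes (play P m) is s :: r then s :: r else [:: (0, 0)]
             | m <- legal_moves P].
  apply: eq_map_legal_moves => m cP.
  by have := IHk (play P m); rewrite -ltnS -cP => /(_ ltk); case: outcomes.
case: (legal_moves P) (legal_moves_neq0 nt) => // m ms _ /=.
by case: outcomes.
Qed.
End Game.

(* Main.v *)
Require Import Defs.
From mathcomp Require Import all_boot.
From mathcomp Require Import zify.

Set Implicit Arguments.
Unset Strict Implicit.
Unset Printing Implicit Defensive.

(* Neither player can force before having seeded, so both seed at least once.
   Since seed counts never decrease, a player whose current count equals his
   final count can do no better; hence (1, 1) is optimal as soon as some line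
   of legal play reaches it. Such a line: Alice and Bob seed the two ends of
   the path and then force towards each other. *)

Section Outcomes.
Variable G : sgraph.
Implicit Types (P : position G) (m : move G) (s : nat * nat) (p : player).

Definition seeds P : nat * nat := (seedsA P, seedsB P).

Definition legal_move P m : bool :=
  match m with
  | Seed v => legal_seed (turn P) (col P) v
  | Force u v => legal_force (turn P) (col P) u v
  end.

Lemma mem_outcomes_movesP P s :
  reflect (exists2 m, legal_move P m & s \in outcomes (play P m))
    (s \in flatten [seq outcomes (play P m) | m <- legal_moves P]).
Proof.
rewrite /legal_moves map_cat -!map_comp flatten_cat mem_cat.
apply: (iffP orP) => [[/flatten_mapP[v]|/flatten_mapP[[u v]]]|[[v|u v] /= mP sm]].
- by rewrite mem_filter => /andP[Sv _]; exists (Seed v).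
- by rewrite mem_filter => /andP[Fuv _]; exists (Force u v).
- by left; apply/flatten_mapP; exists v; rewrite // mem_filter mP mem_enum.
- by right; apply/flatten_mapP; exists (u, v); rewrite // mem_filter mP mem_enum.
Qed.

Lemma card_white_play P m : legal_move P m ->
  #|white (col P)| = #|white (col (play P m))|.+1.
Proof.
case: m => [v /andP[/andP[vW _] _]|u v /legal_force_white] /=;
  exact: card_white_colour.
Qed.

Lemma outcomes_move P s : ~~ terminal P -> s \in outcomes P ->
  exists2 m, legal_move P m & s \in outcomes (play P m).
Proof.
move=> /negPf nt; rewrite outcomesE nt mem_filter => /andP[_].
exact/mem_outcomes_movesP.
Qed.

Lemma seeds_play p P m : seeds_of p (seeds P) <= seeds_of p (seeds (play P m)).
Proof. by case: m => *; rewrite /seeds_of; case: ifP => //= _; lia. Qed.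

Lemma outcomes_ge p P s :
  s \in outcomes P -> seeds_of p (seeds P) <= seeds_of p s.
Proof.
have [k] := ubnP #|white (col P)|; elim: k P => // k IHk P ltk.
have [tP|nt] := boolP (terminal P).
  by rewrite outcomesE tP inE => /eqP->.
case/outcomes_move=> // m mP sm; apply: leq_trans (seeds_play p P m) _.
by apply: IHk sm; rewrite -ltnS -(card_white_play mP).
Qed.

(** The minimality hypothesis asks only for a lower bound on the mover's coordinate over the
    alternatives, so their outcome sets need not be computed. *)
Lemma outcomes_play P m s :
  legal_move P m -> s \in outcomes (play P m) ->
  (forall t m', legal_move P m' -> t \in outcomes (play P m') ->
     seeds_of (turn P) s <= seeds_of (turn P) t) ->
  s \in outcomes P.
Proof.
move=> mP sm smin; rewrite outcomesE.
have /negPf-> : ~~ terminal P by rewrite /terminal -cards_eq0 (card_white_play mP).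
rewrite mem_filter; apply/andP; split; last by apply/mem_outcomes_movesP; exists m.
by apply/allP => t /mem_outcomes_movesP[m' m'P /smin->].
Qed.

(** A force leaves the mover's seed count at its current value, and by [outcomes_ge] no continuation
    ends below that value. *)
Lemma outcomes_force P u v :
  legal_force (turn P) (col P) u v ->
  seeds P \in outcomes (play P (Force u v)) -> seeds P \in outcomes P.
Proof.
move=> Fuv sm; apply: (@outcomes_play _ (Force u v)) Fuv sm _ => t m' _ /(outcomes_ge (turn P)).
exact/leq_trans/seeds_play.
Qed.

(** A force starts from a vertex of the mover's own colour; without one, [m] must be a seed, and its
    contribution to the count persists. *)
Lemma first_move_seeds P m s :
  (forall v, col P v != Some (turn P)) -> legal_move P m ->
  s \in outcomes (play P m) ->
  seeds_of (turn P) (seeds P) < seeds_of (turn P) s.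
Proof.
move=> noP mP /(outcomes_ge (turn P)); apply: leq_trans.
case: m mP => [v _|u v]; last first.
  by rewrite /= /legal_force (negPf (noP u)).
by rewrite /seeds_of; case: P noP => c [] a b /= _; lia.
Qed.

Lemma Zg_eq k : (forall s, s \in outcomes (initial G) -> k <= s.1 + s.2) ->
  (exists2 s, s \in outcomes (initial G) & s.1 + s.2 = k) -> Zg G = k.
Proof.
move=> lb [s0 s0O Es0]; rewrite /Zg.
set s := [seq _ | st <- _].
have ks : k \in s by rewrite -Es0; apply: map_f.
have {lb s0O} : all (leq k) s by apply/allP => _ /mapP[t tO ->]; apply: lb.
(* Generalising the fold's starting value to any [d >= k] lets the induction pass to tails. *)
have : k <= head 0 s -> all (leq k) s -> foldr minn (head 0 s) s = k.
  move: (head 0 s) => d kd; elim: s ks => //= x s IHs.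
  rewrite inE => /predU1P[<-|ks] /andP[kx ks']; last by rewrite IHs //; lia.
  apply/minn_idPl; elim: s ks' {IHs} => //= y s IHs /andP[ky /IHs].
  by rewrite leq_min ky.
move=> E ksall; apply: E => //.
by case: (s) ks ksall => //= x s' _ /andP[].
Qed.

End Outcomes.

Section Path.
Variable n : nat.

(** Blue holds an initial segment and red a final one, the shape kept while the players force
    towards each other; [b = n] makes the red segment empty. *)
Definition race (a b : nat) : colouring (path_graph n) :=
  [ffun i : 'I_n => if i <= a then Some alice
                    else if b <= i then Some bob else None].

Lemma race_forceA a b (u v : 'I_n) : u = a :> nat -> v = a.+1 :> nat ->
  a.+1 < b -> legal_force alice (race a b) u v.
Proof.
move=> ua va ab; rewrite /legal_force ffunE ua leqnn eqxx /=.
apply/eqP/setP => w; rewrite !inE ffunE /= /path_adj ua -val_eqE /= va.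
by do ?[case: ifP => ?]; apply/idP/idP => //=; lia.
Qed.

Lemma race_colourA a b (v : 'I_n) : v = a.+1 :> nat ->
  a.+1 < b -> colour (race a b) v alice = race a.+1 b.
Proof.
move=> va ab; apply/ffunP => w; rewrite !ffunE -val_eqE /= va.
by case: eqP => [->|]; do ?[case: ifP => ?] => //; lia.
Qed.

Lemma race_forceB a b (u v : 'I_n) : u = b.+1 :> nat -> v = b :> nat ->
  a < b -> legal_force bob (race a b.+1) u v.
Proof.
move=> ub vb ab; rewrite /legal_force ffunE ub leqnn ifN -?ltnNge 1?ltnW //.
apply/eqP/setP => w; rewrite !inE ffunE /= /path_adj ub -val_eqE /= vb.
by do ?[case: ifP => ?]; apply/idP/idP => //=; lia.
Qed.

Lemma race_colourB a b (v : 'I_n) : v = b :> nat ->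
  a < b -> colour (race a b.+1) v bob = race a b.
Proof.
move=> vb ab; apply/ffunP => w; rewrite !ffunE -val_eqE /= vb.
by case: eqP => [->|]; do ?[case: ifP => ?] => //; lia.
Qed.

(** While the gap is nonempty, whoever is to move can force into it, which shrinks [b - a] and costs
    no seed; hence the current counts are an outcome. *)
Lemma race_outcome (P : position (path_graph n)) a b :
  a < b < n -> col P = race a b -> seeds P \in outcomes P.
Proof.
have [k] := ubnP (b - a); elim: k a b P => // k IHk a b P ltk /andP[ab bn] cP.
case: (leqP b a.+1) => [ba|].
  rewrite outcomesE ifT ?inE //; apply/eqP/setP => w.
  by rewrite !inE cP ffunE; do ?[case: ifP => //]; lia.
case: P cP => c [] sA sB cP lab; rewrite (cP : c = _) {c cP}.
  have an : a < n by lia.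
  have a1n : a.+1 < n by lia.
  apply: (@outcomes_force (path_graph n) _ (Ordinal an) (Ordinal a1n)).
    exact: race_forceA.
  by apply: (IHk a.+1 b); rewrite /= ?race_colourA //; lia.
(* Bob's turn: the red segment begins at the successor [b.+1], and his force targets [b]. *)
case: b ltk ab bn lab => // b ltk ab bn lab.
apply: (@outcomes_force (path_graph n) _ (Ordinal bn) (Ordinal (ltnW bn))).
  exact: race_forceB.
by apply: (IHk a b); rewrite /= ?race_colourB //; lia.
Qed.

End Path.

Theorem proposition8 (n : nat) (hn : 2 <= n) : Zg (path_graph n) = 2.
Proof.
case: n hn => [|[|n]] // _; set G := path_graph n.+2.
pose P0 := initial G.
have nt0 : ~~ terminal P0 by apply/set0Pn; exists (ord0 : 'I_n.+2); rewrite inE ffunE.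
have noA v : col P0 v != Some (turn P0) by rewrite ffunE.
have noB m v : legal_move P0 m -> col (play P0 m) v != Some bob.
  by case: m => [x|u x] _; rewrite /= !ffunE; case: ifP.
have turnB m : turn (play P0 m) = bob by case: m.
have seedsB0 m : seeds_of bob (seeds (play P0 m)) = 0 by case: m.
(* Lower bound: Alice's first move is a seed, a white vertex remains, and Bob's reply is a seed too
   since nothing is red yet. *)
apply: Zg_eq => [s|].
  case/outcomes_move=> // m mP sm; have := first_move_seeds noA mP sm.
  have nt1 : ~~ terminal (play P0 m).
    rewrite /terminal -cards_eq0 -lt0n -ltnS -(card_white_play mP).
    rewrite (_ : white _ = [set: G]) ?cardsT ?card_ord //.
    by apply/setP => w; rewrite !inE ffunE.
  have [m' m'P sm'] := outcomes_move nt1 sm.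
  have := first_move_seeds _ m'P sm'; rewrite turnB => /(_ (fun v => noB m v mP)).
  by rewrite seedsB0 /seeds_of /=; lia.
have c1E : colour (col P0) (ord0 : 'I_n.+2) alice = race n.+2 0 n.+2.
  apply/ffunP => w; rewrite !ffunE -val_eqE /= leqn0.
  by case: ifP => // _; rewrite leqNgt ltn_ord.
have S0 : legal_move P0 (Seed (ord0 : G)).
  rewrite /= /legal_seed /available_seed inE ffunE eqxx /=.
  apply/andP; split; first by apply/existsPn => u; rewrite /legal_force ffunE.
  apply/implyP => /existsP[u /existsP[w]].
  by rewrite /legal_force ffunE.
have S1 : legal_move (play P0 (Seed (ord0 : G))) (Seed (ord_max : G)).
  rewrite /= c1E; set c := race _ _ _.
  have nB u w : ~~ legal_force bob c u w.
    by rewrite /legal_force ffunE; do ?[case: ifP => //]; have := ltn_ord u; lia.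
  rewrite /legal_seed /available_seed inE ffunE /= ltnn eqxx /=.
  apply/andP; split; first exact/existsPn.
  (* The far end can block Alice's force only when [n = 0], and then it is the only white vertex, so
     the rule permits it. For [n > 0] her force from vertex 0 to vertex 1 stays legal, contradicting
     [blk]. *)
  apply/implyP => blk; apply/forallP => w; apply/implyP => /andP[wW _].
  suff -> : w = (ord_max : G) by [].
  case/existsP: (blk) => u /existsP[x /andP[/andP[cu /eqP cux]]].
  have u0 : u = 0 :> nat.
    by move: cu; rewrite ffunE leqn0; case: ifP => [/eqP|_] //; case: ifP.
  case: (posnP n) => [n0 _|n_gt0 /negP[]].
    apply: ord_inj; move: wW (ltn_ord w); rewrite /= inE ffunE.
    by case: ifP => // + _; lia.
  rewrite /legal_force -cux ffunE -val_eqE /= u0 (eqP cu) eqxx /=.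
  apply/eqP/setP => z; rewrite !inE ffunE -val_eqE /= /path_adj u0.
  by case: ifP => [/eqP ->|_] //=; rewrite eqSS (ltn_eqF n_gt0) andbF.
(* Each opening seed is optimal because every alternative also costs its mover at least one seed;
   after both, the race from the two ends adds none. *)
exists (1, 1) => //; apply: (outcomes_play S0); last first.
  by move=> t m' m'P /(first_move_seeds noA m'P).
apply: (outcomes_play S1); last first.
  by move=> t m' m'P; apply: first_move_seeds m'P => v; apply: noB.
apply: (@race_outcome _ _ 0 n.+1) => //=.
by rewrite c1E race_colourB.
Qed.
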